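(* Let $M\geq m\geq N\geq 2$, and let $\Phi=\{\varphi_k\}_{k=1}^M$ be a frame for $\mathbb{R}^N$. Then the following statements are equivalent: (i) $\Phi$ is $m$-scalable, respectively, strictly $m$-scalable. (ii) There exists a subset $I\subset\{1,\ldots,M\}$ with $\#I=m$ such that $0\in\operatorname{co}(F(\Phi_I))$, respectively, $0\in ri\operatorname{co}(F(\Phi_I))$. (iii) There exists a subset $I\subset\{1,\ldots,M\}$ with $\#I=m$ for which there is no $h\in\mathbb{R}^d$ with $\langle F(\varphi_k),h\rangle>0$ for all $k\in I$, respectively, with $\langle F(\varphi_k),h\rangle\geq 0$ for all $k\in I$, with at least one of the inequalities being strict.
   Context: A frame for $\mathbb{R}^N$ is a finite indexed family $\Phi=\{\varphi_k\}_{k=1}^M\subset\mathbb{R}^N$, $M\ge N$, for which there are constants $A,B>0$ with $A\|x\|^2\le\sum_{k=1}^M|\langle x,\varphi_k\rangle|^2\le B\|x\|^2$ for all $x\in\mathbb{R}^N$; it is tight if one can take $A=B$. For $I\subset\{1,\dots,M\}$, $\Phi_I:=\{\varphi_i\}_{i\in I}$. A frame $\{\varphi_k\}_{k\in J}$ is scalable (respectively, strictly scalable) if there exist nonnegative (respectively, positive) scalars $c_k$, $k\in J$, such that $\{c_k\varphi_k\}_{k\in J}$ is a tight frame for $\mathbb{R}^N$. For $N\le m\le M$, a frame $\Phi=\{\varphi_k\}_{k=1}^M$ is $m$-scalable (respectively, strictly $m$-scalable) if there exists $I\subset\{1,\dots,M\}$ with $\#I=m$ such that $\Phi_I$ is a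 scalable (respectively, strictly scalable) frame for $\mathbb{R}^N$. With $d:=(N-1)(N+2)/2$, the map $F:\mathbb{R}^N\to\mathbb{R}^d$ is defined by stacking the vectors $F_0(x),F_1(x),\ldots,F_{N-1}(x)$, where $F_0(x)=(x_1^2-x_2^2,\,x_1^2-x_3^2,\ldots,x_1^2-x_N^2)^T\in\mathbb{R}^{N-1}$ and $F_k(x)=(x_kx_{k+1},\,x_kx_{k+2},\ldots,x_kx_N)^T\in\mathbb{R}^{N-k}$ for $k=1,\ldots,N-1$. $F(\Phi_I)$ is the matrix with columns $F(\varphi_i)$, $i\in I$, and $\operatorname{co}(F(\Phi_I))$ denotes the convex hull of its columns, i.e. of $\{F(\varphi_i): i\in I\}$, in $\mathbb{R}^d$. The relative interior $ri\operatorname{co}(X)$ of the convex hull of a finite set $X$ is the interior of $\operatorname{co}(X)$ in the topology induced by the affine hull of $X$.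
   Formalization: All frame vectors φ_k are assumed nonzero; with zero vectors allowed the claim fails, e.g. N=2, m=M=3, Φ=(e1, e1+e2, 0): 0=F(0) lies in co(F(Φ)), but Φ is not 3-scalable. *)

(* Defs.v *)
From HB Require Import structures.
From mathcomp Require Import all_boot all_order all_algebra.
From mathcomp Require Import boolp classical_sets reals topology normedtype convex.
From mathcomp Require Import zify.

Set Implicit Arguments.
Unset Strict Implicit.
Unset Printing Implicit Defensive.

Import Order.TTheory GRing.Theory Num.Theory.
Import numFieldNormedType.Exports.

Local Open Scope classical_set_scope.
Local Open Scope ring_scope.

(* The library norm [`|x|] on ['rV[R]_n] is the sup norm, hence the explicit
   Euclidean structure below. *)
Definition dot (R : realType) (n : nat) (x y : 'rV[R]_n) : R :=
  \sum_(i < n) x 0 i * y 0 i.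

Definition enorm (R : realType) (n : nat) (x : 'rV[R]_n) : R :=
  Num.sqrt (dot x x).

(* Subfamilies [{phi_k}_{k in J}] are represented by the full family [phi]
   together with the index set [J]; only the values [phi k], [k \in J], matter. *)
Section Frames.
Variables (R : realType) (N M : nat).
Implicit Types (J : {set 'I_M}) (phi : 'I_M -> 'rV[R]_N).

Definition frame_bounds J phi (A B : R) : Prop :=
  forall x : 'rV[R]_N,
    A * enorm x ^+ 2 <= \sum_(k in J) `|dot x (phi k)| ^+ 2
    /\ \sum_(k in J) `|dot x (phi k)| ^+ 2 <= B * enorm x ^+ 2.

Definition frame J phi : Prop :=
  (N <= #|J|)%N /\ exists A B : R, 0 < A /\ 0 < B /\ frame_bounds J phi A B.

Definition tight_frame J phi : Prop :=
  (N <= #|J|)%N /\ exists A : R, 0 < A /\ frame_bounds J phi A A.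

Definition scalable J phi : Prop :=
  exists c : 'I_M -> R,
    (forall k, k \in J -> 0 <= c k) /\ tight_frame J (fun k => c k *: phi k).

Definition strictly_scalable J phi : Prop :=
  exists c : 'I_M -> R,
    (forall k, k \in J -> 0 < c k) /\ tight_frame J (fun k => c k *: phi k).

Definition m_scalable (m : nat) phi : Prop :=
  exists I : {set 'I_M}, #|I| = m /\ frame I phi /\ scalable I phi.

Definition strictly_m_scalable (m : nat) phi : Prop :=
  exists I : {set 'I_M}, #|I| = m /\ frame I phi /\ strictly_scalable I phi.

End Frames.

Definition quad_dim (N : nat) : nat := ((N - 1) * (N + 2)) %/ 2.

(* Length of the block [F_k]: [N - 1] for [k = 0], [N - k] for [1 <= k]. *)
Definition block_dim (N k : nat) : nat := (N - maxn 1 k)%N.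

Lemma sum_block_dim (N : nat) :
  (\sum_(k < N) block_dim N k = quad_dim N)%N.
Proof.
case: N => [|n]; first by rewrite big_ord0.
have -> : (\sum_(k < n.+1) block_dim n.+1 k = n + 'C(n.+1, 2))%N.
  rewrite big_ord_recl -bin2_sum big_mkord [in RHS]big_ord_recl add0n.
  rewrite [in RHS](reindex_inj rev_ord_inj); congr (_ + _)%N.
    by rewrite /block_dim subn1.
  apply: eq_bigr => i _.
  by rewrite lift0 /block_dim (maxn_idPr _) // lift0 /= subSS subnSK.
rewrite /quad_dim -(mulnK (n + _)%N (isT : 0 < 2)%N); congr (_ %/ 2)%N.
by rewrite mulnDl -[('C(_, 2) * 2)%N]mulnC -mul_bin_diag bin1; lia.
Qed.

(* The coordinate [x_i] numbered from 1; it is only used for [1 <= i <= n]. *)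
Definition coord1 (R : realType) (n : nat) (x : 'rV[R]_n) (i : nat) : R :=
  nth 0 [seq x 0 l | l : 'I_n] i.-1.

Definition F_block (R : realType) (N : nat) (x : 'rV[R]_N) (k : nat) :
    'rV[R]_(block_dim N k) :=
  \row_j (if k == 0%N then coord1 x 1 ^+ 2 - coord1 x (j + 2) ^+ 2
          else coord1 x k * coord1 x (k + j + 1)).

Definition F_map (R : realType) (N : nat) (x : 'rV[R]_N) : 'rV[R]_(quad_dim N) :=
  castmx (erefl, sum_block_dim N) (\mxrow_(k < N) F_block x k).

Definition F_image (R : realType) (N M : nat) (phi : 'I_M -> 'rV[R]_N)
    (I : {set 'I_M}) : set 'rV[R]_(quad_dim N) :=
  [set F_map (phi i) | i in [set` I]].

Section Hulls.
Variables (R : realType) (d : nat).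
Implicit Type X : set 'rV[R]_d.

Definition convex_hull X : set 'rV[R]_d :=
  smallest (@convex_set R 'rV[R]_d) X.

Definition affine_set X : Prop :=
  forall (x y : 'rV[R]_d) (t : R), X x -> X y -> X (t *: x + (1 - t) *: y).

Definition affine_hull X : set 'rV[R]_d := smallest affine_set X.

(* The interior is taken in [subspace (affine_hull X)]. That type makes the
   points outside [affine_hull X] isolated, which is harmless here because
   [convex_hull X] is contained in [affine_hull X]. *)
Definition ri_convex_hull X : set 'rV[R]_d :=
  @interior (subspace (affine_hull X)) (convex_hull X).

End Hulls.

(* Main.v *)
(** A nonnegative combination [\sum_k w_k F(phi_k)] vanishes exactly when
    [\sum_k w_k phi_k^T phi_k] is a multiple of the identity, i.e. when the vectors
    [sqrt(w_k) phi_k] form a tight frame (the multiple is positive because no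
    [phi_k] is zero). So scalability of [Phi_I] is the existence of a vanishing
    convex combination of the [F(phi_k)], and strict scalability that of a vanishing
    combination with all coefficients positive. Gordan's and Stiemke's theorems of
    the alternative, both consequences of Farkas' lemma, turn these into (iii). In
    the strict case, if [0] lies in the relative interior, then so close to [0] that
    the hull still contains it lies some [- e F(phi_k)], which no [h] as in (iii)
    tolerates. *)
Require Import Defs.
From HB Require Import structures.
From mathcomp Require Import all_boot all_order all_algebra.
From mathcomp Require Import boolp classical_sets reals topology normedtype convex.
From mathcomp Require Import interval_inference ring lra zify.

Set Implicit Arguments.
Unset Strict Implicit.
Unset Printing Implicit Defensive.

Import Order.TTheory GRing.Theory Num.Theory.
Import numFieldNormedType.Exports.

Local Open Scope classical_set_scope.
Local Open Scope ring_scope.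

(** * The Euclidean inner product *)

Section Dot.
Variables (R : realType) (d : nat).
Implicit Types (x y h : 'rV[R]_d) (a : R).

Lemma dotC x y : dot x y = dot y x.
Proof. by apply: eq_bigr => i _; rewrite mulrC. Qed.

Lemma dotDl x y h : dot (x + y) h = dot x h + dot y h.
Proof. by rewrite -big_split; apply: eq_bigr => i _; rewrite mxE mulrDl. Qed.

Lemma dotZl a x h : dot (a *: x) h = a * dot x h.
Proof. by rewrite mulr_sumr; apply: eq_bigr => i _; rewrite mxE mulrA. Qed.

Lemma dotDr x y h : dot h (x + y) = dot h x + dot h y.
Proof. by rewrite !(dotC h) dotDl. Qed.

Lemma dotZr a x h : dot h (a *: x) = a * dot h x.
Proof. by rewrite !(dotC h) dotZl. Qed.

Lemma dot0l h : dot 0 h = 0.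
Proof. by rewrite -(scale0r 0) dotZl mul0r. Qed.

Lemma dotNl x h : dot (- x) h = - dot x h.
Proof. by rewrite -scaleN1r dotZl mulN1r. Qed.

Lemma dotNr x h : dot h (- x) = - dot h x.
Proof. by rewrite !(dotC h) dotNl. Qed.

Lemma dot_ge0 x : 0 <= dot x x.
Proof. by apply: sumr_ge0 => i _; rewrite -expr2 sqr_ge0. Qed.

Lemma dot_eq0 x : (dot x x == 0) = (x == 0).
Proof.
apply/idP/eqP => [|->]; last by rewrite dot0l.
rewrite psumr_eq0 => [/allP x0|i _]; last by rewrite -expr2 sqr_ge0.
apply/rowP => i; rewrite mxE.
by have := x0 i (mem_index_enum i); rewrite mulf_eq0 orbb => /eqP.
Qed.

Lemma enorm_sqr x : enorm x ^+ 2 = dot x x.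
Proof. by rewrite sqr_sqrtr ?dot_ge0. Qed.

Lemma dot_delta x (i : 'I_d) : dot (delta_mx 0 i) x = x 0 i.
Proof.
rewrite /dot (bigD1 i) //= big1 => [|j /negPf ji]; rewrite mxE eqxx /=.
  by rewrite eqxx mul1r addr0.
by rewrite ji mul0r.
Qed.

End Dot.

(** * Farkas' lemma and the theorems of the alternative *)

Lemma dot_row_mx (R : realType) (p q : nat) (x1 y1 : 'rV[R]_p) (x2 y2 : 'rV[R]_q) :
  dot (row_mx x1 x2) (row_mx y1 y2) = dot x1 y1 + dot x2 y2.
Proof.
by rewrite /dot big_split_ord; congr (_ + _); apply: eq_bigr => i _;
  rewrite ?row_mxEl ?row_mxEr.
Qed.

(* Induction on the number of generators (Bartl's algebraic proof): if [h]
   separates [b] from the cone of [s] but is negative on the new generator [v a],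
   project everything along [v a] onto the hyperplane orthogonal to [h]. *)
Lemma farkas_seq (R : realType) (d : nat) (T : eqType) (s : seq T)
    (v : T -> 'rV[R]_d) (b : 'rV[R]_d) :
  uniq s ->
  (exists c : T -> R, (forall k, 0 <= c k) /\ b = \sum_(k <- s) c k *: v k) \/
  (exists h, (forall k, k \in s -> 0 <= dot (v k) h) /\ dot b h < 0).
Proof.
elim: s v b => [|a s IH] v b.
  move=> _; have [->|b0] := eqVneq b 0.
    by left; exists (fun=> 0); rewrite big_nil.
  right; exists (- b); split=> //.
  by rewrite dotC dotNl oppr_lt0 lt_def dot_eq0 b0 dot_ge0.
case/andP=> as_ us.
have upd (x : R) (c : T -> R) (w : T -> 'rV[R]_d) :
    \sum_(k <- s) (if k == a then x else c k) *: w k = \sum_(k <- s) c k *: w k.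
  apply: eq_big_seq => k ks; case: eqP => // ka.
  by rewrite -ka ks in as_.
case: (IH v b us) => [[c [c0 bE]]|[x [xs bx]]].
  left; exists (fun k => if k == a then 0 else c k); split.
    by move=> k; case: ifP.
  by rewrite big_cons eqxx scale0r add0r upd.
have [ax|ax] := leP 0 (dot (v a) x).
  right; exists x; split=> // k; rewrite inE => /orP[/eqP->//|]; exact: xs.
set t := dot (v a) x in ax.
have t0 : t != 0 by rewrite lt_eqF.
pose pr (u : 'rV[R]_d) := u - (dot u x / t) *: v a.
case: (IH (fun k => pr (v k)) (pr b) us) => [[c [c0 bE]]|[h [hs bh]]].
  left.
  (* The coefficient of [v a] left over when [b] and all [v k] are split along [pr]. It is
     nonnegative since [dot b x] and [t] are negative and each [dot (v k) x] is nonnegative. *)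
  pose ca := dot b x / t - \sum_(k <- s) c k * (dot (v k) x / t).
  exists (fun k => if k == a then ca else c k); split.
    move=> k; case: ifP => // _; rewrite subr_ge0.
    apply: (@le_trans _ _ 0).
      rewrite big_seq; apply: sumr_le0 => i si; apply: mulr_ge0_le0 => //.
      by apply: mulr_ge0_le0; [exact: xs|rewrite invr_le0 ltW].
    by apply: mulr_le0; [exact: ltW|rewrite invr_le0 ltW].
  rewrite big_cons eqxx upd /ca scalerBl.
  have vE k : v k = pr (v k) + (dot (v k) x / t) *: v a by rewrite subrK.
  under [X in _ = _ + X]eq_bigr => k _ do rewrite [X in _ *: X]vE scalerDr.
  rewrite big_split /= -bE /pr scaler_suml.
  under [X in _ + (_ + X)]eq_bigr do rewrite scalerA.
  by rewrite [RHS]addrC addrACA subrK subrr addr0.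
(* The adjoint of [pr] applied to [h]: pairing it with [u] gives [dot (pr u) h], which is zero for
   [u = v a]. *)
right; exists (h - (dot (v a) h / t) *: x).
have prE u : dot u (h - (dot (v a) h / t) *: x) = dot (pr u) h.
  by rewrite /pr dotDr dotNr dotZr dotDl dotNl dotZl; field.
split; last by rewrite prE.
move=> k; rewrite inE => /orP[/eqP->|ks]; rewrite prE; last exact: hs.
by rewrite /pr divff // scale1r subrr dot0l.
Qed.

Section Alternatives.
Variables (R : realType) (d : nat) (T : finType) (I : {set T}).
Implicit Type v : T -> 'rV[R]_d.

Lemma farkas v (b : 'rV[R]_d) :
  (exists c : T -> R, (forall k, 0 <= c k) /\ b = \sum_(k in I) c k *: v k) \/
  (exists h, (forall k, k \in I -> 0 <= dot (v k) h) /\ dot b h < 0).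
Proof.
case: (farkas_seq v b (enum_uniq I)) => [[c [c0 bE]]|[h [hI bh]]].
  by left; exists c; split=> //; rewrite bE -big_enum.
by right; exists h; split=> // k kI; apply: hI; rewrite mem_enum.
Qed.

(* Farkas' lemma for the lifted vectors [(1, v k)] and the target [(1, 0)]. *)
Lemma gordan v :
  ~ (exists h, forall k, k \in I -> 0 < dot (v k) h) ->
  exists c : T -> R, [/\ forall k, 0 <= c k, \sum_(k in I) c k = 1 &
    \sum_(k in I) c k *: v k = 0].
Proof.
move=> noh.
case: (@farkas_seq R (1 + d) T (enum I) (fun k => row_mx (1%:M) (v k))
  (row_mx (1%:M) 0) (enum_uniq I)) => [[c [c0 bE]]|[h [hI]]].
  exists c; split=> //.
    have /(congr1 (fun u : 'rV_(1 + d) => u 0 (lshift d 0))) := bE.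
    rewrite row_mxEl mxE eqxx mulr1n summxE big_enum /= => ->.
    by apply: eq_bigr => k _; rewrite mxE row_mxEl mxE eqxx mulr1.
  apply/rowP => j; have /(congr1 (fun u : 'rV_(1 + d) => u 0 (rshift 1 j))) := bE.
  rewrite row_mxEr !summxE big_enum /= => ->.
  by apply: eq_bigr => k _; rewrite [LHS]mxE [RHS]mxE row_mxEr.
(* The first coordinate of the separator is negative, so the inequalities on the lifted vectors
   become strict for its remaining part. *)
rewrite -[h]hsubmxK dot_row_mx dot0l addr0 => h0.
case: noh; exists (rsubmx h) => k kI.
have := hI k; rewrite mem_enum -[h]hsubmxK dot_row_mx row_mxKr => /(_ kI).
by lra.
Qed.

(** By Farkas every [- v i] lies in the cone of the family. Summing the resulting relations over [i]
    gives a vanishing combination in which each coefficient is at least 1. *)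
Lemma stiemke v :
  ~ (exists h, (forall k, k \in I -> 0 <= dot (v k) h) /\
      exists k, k \in I /\ 0 < dot (v k) h) ->
  exists c : T -> R, (forall k, 0 < c k) /\ \sum_(k in I) c k *: v k = 0.
Proof.
move=> noh.
(* Membership sits under the existential so that [choice] applies to all of [T]. *)
have cone i : exists c : T -> R, i \in I ->
    (forall k, 0 <= c k) /\ - v i = \sum_(k in I) c k *: v k.
  case: (boolP (i \in I)) => [iI|_]; last by exists (fun=> 0).
  case: (farkas v (- v i)) => [[c cP]|[h [hI hi]]]; first by exists c.
  by case: noh; exists h; split=> //; exists i; split=> //; rewrite -oppr_lt0 -dotNl.
have [c cP] := choice cone.
exists (fun k => 1 + \sum_(i in I) c i k); split=> [k|].
  by rewrite ltr_wpDr // sumr_ge0 // => i /cP [].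
under eq_bigr do rewrite scalerDl scale1r scaler_suml.
rewrite big_split exchange_big /= -big_split big1 //= => i iI.
by have [_ <-] := cP i iI; rewrite addrN.
Qed.

End Alternatives.

(** * Convex hulls, affine hulls and relative interiors *)

Section Hull.
Variables (R : realType) (d : nat).
Implicit Types (C X : set 'rV[R]_d) (x y h : 'rV[R]_d).

Lemma convex_setP C :
  @convex_set R 'rV[R]_d C <->
  forall x y (t : R), C x -> C y -> 0 <= t -> t <= 1 -> C (t *: x + (1 - t) *: y).
Proof.
split=> [cC x y t Cx Cy t0 t1|cC x y l].
  by have := cC x y (Itv01 t0 t1); rewrite !inE; apply.
by rewrite !inE => Cx Cy; exact: cC.
Qed.

Lemma smallest_convex X : @convex_set R 'rV[R]_d (convex_hull X).
Proof.
apply/convex_setP => x y t Hx Hy t0 t1 C [cC XC].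
by apply: (convex_setP C).1 => //; [exact: Hx|exact: Hy].
Qed.

Lemma sub_convex_hull X : X `<=` convex_hull X.
Proof. exact: sub_gen_smallest. Qed.

Lemma convex_hull_ge0 X h :
  (forall x, X x -> 0 <= dot x h) -> forall x, convex_hull X x -> 0 <= dot x h.
Proof.
move=> Xh; apply: smallest_sub => //; apply/convex_setP => x y t /= hx hy t0 t1.
by rewrite dotDl !dotZl addr_ge0 // mulr_ge0 // subr_ge0.
Qed.

Lemma convex_hull_gt0 X h :
  (forall x, X x -> 0 < dot x h) -> forall x, convex_hull X x -> 0 < dot x h.
Proof.
move=> Xh; apply: smallest_sub => //; apply/convex_setP => x y t /= hx hy t0 t1.
rewrite dotDl !dotZl; have [->|tn0] := eqVneq t 0.
  by rewrite mul0r add0r subr0 mul1r.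
rewrite ltr_pwDl //; first by rewrite mulr_gt0 // lt_def tn0.
by rewrite mulr_ge0 ?subr_ge0 // ltW.
Qed.

(** Leaving the total weight unnormalised lets the induction on [s] go through; [x] is the default
    point when that weight is 0. *)
Lemma convex_sum_seq C x (T : eqType) (s : seq T) (c : T -> R) (v : T -> 'rV[R]_d) :
  @convex_set R 'rV[R]_d C -> C x ->
  (forall k, k \in s -> 0 <= c k) -> (forall k, k \in s -> C (v k)) ->
  exists2 y, C y & \sum_(k <- s) c k *: v k = (\sum_(k <- s) c k) *: y.
Proof.
move=> /convex_setP cC Cx; elim: s => [|a s IH] c0 Cv.
  by exists x => //; rewrite !big_nil scale0r.
case: IH => [k ks|k ks|y Cy yE]; first by apply: c0; rewrite inE ks orbT.
  by apply: Cv; rewrite inE ks orbT.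
have ca0 : 0 <= c a by apply: c0; rewrite inE eqxx.
have S0 : 0 <= \sum_(k <- s) c k.
  by rewrite big_seq sumr_ge0 // => k ks; apply: c0; rewrite inE ks orbT.
rewrite !big_cons yE; set S := \sum_(k <- s) c k in S0 *.
have [cS|cS] := eqVneq (c a + S) 0.
  have [-> ->] : c a = 0 /\ S = 0 by split; lra.
  by exists x; rewrite // !(scale0r, addr0).
have cSp : 0 < c a + S by rewrite lt_def cS addr_ge0.
exists ((c a / (c a + S)) *: v a + (1 - c a / (c a + S)) *: y).
  apply: cC => //; first by apply: Cv; rewrite inE eqxx.
    by rewrite divr_ge0 // ltW.
  by rewrite ler_pdivrMr // mul1r lerDl.
by rewrite scalerDr !scalerA; congr (_ *: _ + _ *: _); field.
Qed.

Lemma convex_sum C (T : finType) (I : {set T}) (c : T -> R) (v : T -> 'rV[R]_d) :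
  @convex_set R 'rV[R]_d C -> (forall k, k \in I -> C (v k)) ->
  (forall k, k \in I -> 0 <= c k) -> \sum_(k in I) c k = 1 ->
  C (\sum_(k in I) c k *: v k).
Proof.
move=> cC Cv c0 c1.
have [I0|[i iI]] := set_0Vmem I.
  by move/eqP: c1; rewrite I0 big_set0 eq_sym oner_eq0.
have [||y Cy] := @convex_sum_seq C (v i) T (enum I) c v cC (Cv i iI).
- by move=> k; rewrite mem_enum; exact: c0.
- by move=> k; rewrite mem_enum; exact: Cv.
by rewrite !big_enum /= c1 scale1r => ->.
Qed.

Lemma sub_affine_hull X : X `<=` affine_hull X.
Proof. exact: sub_gen_smallest. Qed.

Lemma affine_hull_affine X : affine_set (affine_hull X).
Proof. by move=> x y t Hx Hy C CX; apply: CX.1; [exact: (Hx C)|exact: (Hy C)]. Qed.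

Lemma convex_hull_sub_affine_hull X : convex_hull X `<=` affine_hull X.
Proof.
apply: smallest_sub; last exact: sub_affine_hull.
by apply/convex_setP => x y t Hx Hy _ _; exact: affine_hull_affine.
Qed.

(** A point of the hull lies in the affine hull, where neighbourhoods in [subspace] are traces of
    the ambient ones. *)
Lemma ri_convex_hullP X x : convex_hull X x ->
  ri_convex_hull X x <-> \forall y \near x, affine_hull X y -> convex_hull X y.
Proof.
move=> /convex_hull_sub_affine_hull ax; rewrite /ri_convex_hull /interior /=.
by rewrite [nbhs (x : subspace _)](_ : _ = within (affine_hull X) (nbhs x)) //;
  rewrite nbhs_subspace_in.
Qed.

Lemma ri_convex_hull_sub X : ri_convex_hull X `<=` convex_hull X.
Proof. exact: (@interior_subset (subspace (affine_hull X)) (convex_hull X)). Qed.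

(** The line through [v] and 0 stays in the affine hull, so a short step beyond 0 stays in the
    convex hull. *)
Lemma ri_convex_hull_opp X v : ri_convex_hull X 0 -> X v ->
  exists2 e : R, 0 < e & convex_hull X (- e *: v).
Proof.
move=> riX Xv; have hX := ri_convex_hull_sub riX.
have /nbhs_ballP[e /= e0 eX] := (ri_convex_hullP hX).1 riX.
(* Adding 1 covers [v = 0] and keeps the step strictly inside the ball of radius [e]. *)
have vp : 0 < `|v| + 1 by rewrite ltr_wpDl.
exists (e / (`|v| + 1)); first exact: divr_gt0.
apply: eX.
  rewrite -ball_normE /= sub0r normrN normrZ normrN gtr0_norm ?divr_gt0 //.
  by rewrite mulrAC ltr_pdivrMr // ltr_pM2l // ltrDl.
have := @affine_hull_affine X v 0 (- (e / (`|v| + 1))).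
rewrite scaler0 addr0; apply; first exact: sub_affine_hull.
exact: convex_hull_sub_affine_hull.
Qed.

Lemma mulmx_entry_continuous p (P : 'M[R]_(d, p)) i :
  continuous (fun y : 'rV[R]_d => (y *m P) 0 i).
Proof.
under eq_fun do rewrite mxE.
apply: continuous_big => [|j _]; first exact: add_continuous.
by move=> y; exact: (@cvgM _ _ (nbhs y) _ _ _ _ _
  (@coord_continuous R 1 d 0 j y) (cvg_cst _)).
Qed.

(* A point [y] near [0] of the affine hull is [\sum_k b k *: v k] with [b] small
   and depending linearly on [y]; adding [(1 - \sum b) *: \sum_k c k *: v k = 0]
   turns this into a convex combination. *)
Lemma positive_comb_ri_convex_hull (M : nat) (I : {set 'I_M}) (c : 'I_M -> R)
    (v : 'I_M -> 'rV[R]_d) :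
  (0 < #|I|)%N -> (forall k, k \in I -> 0 < c k) -> \sum_(k in I) c k *: v k = 0 ->
  ri_convex_hull [set v k | k in [set` I]] 0.
Proof.
wlog c1 : c / \sum_(k in I) c k = 1 => [wlg|] I0 c0 cv.
  have S0 : 0 < \sum_(k in I) c k.
    by case/card_gt0P: I0 => i iI; rewrite (bigD1 i) //= ltr_pwDl ?c0 //
      sumr_ge0 // => k /andP[/c0/ltW].
  apply: (wlg (fun k => (\sum_(k in I) c k)^-1 * c k)) => //.
  - by rewrite -mulr_sumr mulVf // gt_eqF.
  - by move=> k kI; rewrite mulr_gt0 ?invr_gt0 ?c0.
  - by under eq_bigr do rewrite -scalerA; rewrite -scaler_sumr cv scaler0.
set X := [set _ | _ in _].
have Xv k : k \in I -> convex_hull X (v k).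
  by move=> kI; apply: sub_convex_hull; exists k.
have hX : convex_hull X 0.
  rewrite -cv; apply: convex_sum => //; first exact: smallest_convex.
  by move=> k /c0/ltW.
apply/ri_convex_hullP => //.
(* Rows outside [I] are zero, so the row space is the span of the [v k] with [k] in [I]; being
   linear, it contains the affine hull. *)
pose V := \matrix_(k < M) (if k \in I then v k else 0).
have XV y : affine_hull X y -> (y <= V)%MS.
  apply: (@smallest_sub _ _ _ [set y | (y <= V)%MS]).
    by move=> a b t /= aV bV; rewrite addmx_sub ?scalemx_sub.
  move=> _ [k /= kI <-].
  suff -> : v k = row k V by exact: row_sub.
  by rewrite rowK kI.
(* The pseudo-inverse selects coefficients linear in [y], hence continuous and zero at 0. *)
pose b (y : 'rV[R]_d) := y *m pinvmx V.
have bv y : affine_hull X y -> y = \sum_(k in I) b y 0 k *: v k.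
  move=> /XV yV; rewrite -[LHS](mulmxKpV yV) mulmx_sum_row [RHS]big_mkcond /=.
  by apply: eq_bigr => k _; rewrite rowK; case: ifP => //; rewrite scaler0.
have sum_continuous : continuous (fun y => \sum_(i in I) b y 0 i).
  apply: continuous_big => [|i _]; first exact: add_continuous.
  exact: mulmx_entry_continuous.
(* At [y = 0] the coefficients are the [c k], which are positive; finitely many strict inequalities
   persist nearby. *)
have pos : \forall y \near (0 : 'rV[R]_d),
    forall k, k \in I -> 0 < b y 0 k + (1 - \sum_(i in I) b y 0 i) * c k.
  apply: (@filter_forall _ 'I_M (fun k (y : 'rV[R]_d) => k \in I ->
    0 < b y 0 k + (1 - \sum_(i in I) b y 0 i) * c k) (nbhs (0 : 'rV[R]_d))) => k.
  case: (boolP (k \in I)) => [kI|_]; last exact: nearW.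
  apply: filter_imply => _.
  pose g (y : 'rV[R]_d) := b y 0 k + (1 - \sum_(i in I) b y 0 i) * c k.
  have g0 : g 0 = c k.
    rewrite /g /b mul0mx mxE add0r big1 ?subr0 ?mul1r // => i _.
    by rewrite mxE.
  have : g y @[y --> (0 : 'rV[R]_d)] --> g 0.
    have g_cvg := (@cvgD _ _ _ (nbhs (0 : 'rV[R]_d)) _ _ _ _ _
      (@mulmx_entry_continuous _ (pinvmx V) k 0)
      (@cvgM _ _ (nbhs (0 : 'rV[R]_d)) _ _ _ _ _
        (@cvgB _ _ _ (nbhs (0 : 'rV[R]_d)) _ _ _ _ _ (cvg_cst (1 : R))
          (sum_continuous 0)) (cvg_cst (c k)))).
    exact: g_cvg.
  rewrite g0 => gc.
  exact: (@cvgr_gt R _ (nbhs (0 : 'rV[R]_d)) _ g _ gc 0 (c0 k kI)).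
near=> y => ay.
have -> : y = \sum_(k in I) (b y 0 k + (1 - \sum_(i in I) b y 0 i) * c k) *: v k.
  under eq_bigr do rewrite scalerDl -scalerA.
  by rewrite big_split /= -scaler_sumr cv scaler0 addr0 -bv.
apply: convex_sum => //; first exact: smallest_convex.
  by move=> k kI; apply/ltW; move: k kI; near: y.
by rewrite big_split /= -mulr_sumr c1 mulr1 addrC subrK.
Unshelve. all: by end_near. Qed.

End Hull.

(** * The map [F_map] and second moments *)

Section QuadraticMap.
Variables (R : realType) (T : finType) (I : {set T}).

Lemma coord1E (n : nat) (x : 'rV[R]_n) (i : 'I_n) : coord1 x i.+1 = x 0 i.
Proof. by rewrite /coord1 /image_mem (nth_map i) ?size_enum_ord //= nth_ord_enum. Qed.

Lemma lincomb_F_map_eq0 (N : nat) (w : T -> R) (phi : T -> 'rV[R]_N) :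
  \sum_(k in I) w k *: F_map (phi k) = 0 <->
  forall (l : 'I_N) (j : 'I_(block_dim N l)),
    \sum_(k in I) w k * F_block (phi k) l 0 j = 0.
Proof.
(* Generalising the dimension together with its equation turns the cast into the identity. *)
rewrite /F_map; move: (quad_dim N) (sum_block_dim N) => d e; case: d / e.
rewrite (eq_bigr (fun k => w k *: \mxrow_(l < N) F_block (phi k) l)); last first.
  by move=> k _; rewrite castmx_id.
have E s : (\sum_(k in I) w k *: \mxrow_(l < N) F_block (phi k) l) 0 s =
    \sum_(k in I) w k * F_block (phi k) (tagnat.sig1 s) 0 (tagnat.sig2 s).
  by rewrite summxE; apply: eq_bigr => k _; rewrite !mxE.
split=> [w0 l j|w0]; last by apply/rowP => s; rewrite E mxE w0.
transitivity (submxrow (\sum_(k in I) w k *: \mxrow_(l < N) F_block (phi k) l) l 0 j).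
  rewrite [RHS]mxE summxE; apply: eq_bigr => k _; rewrite [RHS]mxE; congr (_ * _).
  by rewrite -[F_block _ _](mxrowK (fun l : 'I_N => F_block (phi k) l) l) mxE.
by rewrite w0 !mxE.
Qed.

(** The entries of the weighted frame operator [\sum_k w_k phi_k^T phi_k]. *)
Definition moment (N : nat) (w : T -> R) (phi : T -> 'rV[R]_N) (i j : 'I_N) : R :=
  \sum_(k in I) w k * (phi k 0 i * phi k 0 j).

Lemma momentC (N : nat) (w : T -> R) (phi : T -> 'rV[R]_N) i j :
  moment w phi i j = moment w phi j i.
Proof. by apply: eq_bigr => k _; rewrite [phi k 0 i * _]mulrC. Qed.

(** Block 0 compares the diagonal moments with the first one; the other blocks list the moments
    above the diagonal, and symmetry gives those below. *)
Lemma lincomb_F_map_momentP (n : nat) (w : T -> R) (phi : T -> 'rV[R]_n.+1) :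
  \sum_(k in I) w k *: F_map (phi k) = 0 <->
  forall i j, moment w phi i j = moment w phi 0 0 *+ (i == j).
Proof.
rewrite lincomb_F_map_eq0; split=> [w0|wE].
  have off (i j : 'I_n.+1) : (i < j)%N -> moment w phi i j = 0.
    (* Coordinates in [F_block] count from 1, so the pair [(i, j)] is entry [j - i.+1] of block
       [i.+1]. *)
    move=> ij; have iN : (i.+1 < n.+1)%N by have := ltn_ord j; lia.
    have jb : (j - i.+1 < block_dim n.+1 (Ordinal iN))%N.
      by rewrite /block_dim /=; have := ltn_ord j; lia.
    rewrite -[RHS](w0 (Ordinal iN) (Ordinal jb)); apply: eq_bigr => k _.
    rewrite mxE /= -!coord1E; congr (_ * (_ * coord1 _ _)); lia.
  move=> i j; case: (ltngtP i j) => [ij|ji|/val_inj ->]; last first.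
  (* For [j = lift 0 j'], entry [j'] of block 0 is the difference of the squares of coordinates 0
     and [j]. *)
  - rewrite eqxx mulr1n; case: (unliftP 0 j) => [j'|] -> //.
    have jb : (j' < block_dim n.+1 (ord0 : 'I_n.+1))%N.
      have := ltn_ord j'; rewrite /block_dim /=; lia.
    apply/eqP; rewrite eq_sym -subr_eq0 -[X in _ == X](w0 ord0 (Ordinal jb)).
    rewrite -sumrB; apply/eqP; apply: eq_bigr => k _.
    rewrite -mulrBr mxE /= -!expr2 -!coord1E; congr (_ * (_ - coord1 _ _ ^+ 2)).
    by rewrite lift0; lia.
  - by rewrite momentC off // gt_eqF.
  - by rewrite off // lt_eqF.
move=> [[|l] lN] j.
  have jN : (j.+1 < n.+1)%N by have := ltn_ord j; rewrite /block_dim /=; lia.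
  have := wE (Ordinal jN) (Ordinal jN); rewrite eqxx mulr1n => /eqP.
  rewrite eq_sym -subr_eq0 => /eqP jE; rewrite -[RHS]jE -sumrB; apply: eq_bigr => k _.
  rewrite -mulrBr mxE /= -!expr2 -!coord1E; congr (_ * (_ - coord1 _ _ ^+ 2)).
  by rewrite /=; lia.
have ljN : (l.+1 + j < n.+1)%N by have := ltn_ord j; rewrite /block_dim /=; lia.
have lN' : (l < n.+1)%N by lia.
have := wE (Ordinal lN') (Ordinal ljN).
rewrite -val_eqE /= (_ : (l == l.+1 + j)%N = false); last by lia.
rewrite mulr0n => mlE; rewrite -[RHS]mlE; apply: eq_bigr => k _.
rewrite mxE /= -!coord1E.
by congr (_ * (_ * coord1 _ _)); rewrite /=; lia.
Qed.

End QuadraticMap.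

(** * Tight frames as vanishing combinations *)

Section Frames.
Variables (R : realType) (M : nat) (I : {set 'I_M}).

Lemma sum_sqr_dot (n : nat) (w : 'I_M -> R) (phi : 'I_M -> 'rV[R]_n) x :
  \sum_(k in I) w k * dot x (phi k) ^+ 2 =
  \sum_i \sum_j x 0 i * x 0 j * moment I w phi i j.
Proof.
under [RHS]eq_bigr do under eq_bigr do rewrite mulr_sumr.
under [RHS]eq_bigr do rewrite exchange_big.
rewrite [RHS]exchange_big /=; apply: eq_bigr => k _.
rewrite expr2 big_distrlr /= mulr_sumr; apply: eq_bigr => i _.
by rewrite mulr_sumr; apply: eq_bigr => j _; ring.
Qed.

Lemma sum_sqr_dotP (n : nat) (w : 'I_M -> R) (phi : 'I_M -> 'rV[R]_n) (A : R) :
  (forall x, \sum_(k in I) w k * dot x (phi k) ^+ 2 = A * dot x x) <->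
  forall i j, moment I w phi i j = A *+ (i == j).
Proof.
split=> [wA|mE x].
  have diag i : moment I w phi i i = A.
    have := wA (delta_mx 0 i); rewrite dot_delta mxE !eqxx mulr1 => <-.
    by apply: eq_bigr => k _; rewrite dot_delta expr2.
  move=> i j; case: eqVneq => [->|ij]; first by rewrite diag.
  (* Polarisation: the diagonal moments already account for [2 * A], so the cross term vanishes. *)
  have := wA (delta_mx 0 i + delta_mx 0 j).
  rewrite dotDl !dot_delta !mxE !eqxx /= [j == i]eq_sym (negPf ij).
  have E k : w k * dot (delta_mx 0 i + delta_mx 0 j) (phi k) ^+ 2 =
      w k * (phi k 0 i * phi k 0 i) + w k * (phi k 0 j * phi k 0 j)
      + 2 * (w k * (phi k 0 i * phi k 0 j)) by rewrite dotDl !dot_delta; ring.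
  rewrite (eq_bigr _ (fun k _ => E k)) !big_split -mulr_sumr /=.
  have := diag i; have := diag j; rewrite /moment => -> ->; lra.
rewrite sum_sqr_dot mulr_sumr; apply: eq_bigr => i _.
rewrite (bigD1 i) //= big1 => [|j /negPf ji].
  by rewrite mE eqxx addr0 mulr1n mulrC.
by rewrite mE eq_sym ji mulr0.
Qed.

Lemma frame_bounds_scaleP (n : nat) (c : 'I_M -> R) (phi : 'I_M -> 'rV[R]_n) (A : R) :
  frame_bounds I (fun k => c k *: phi k) A A <->
  forall x, \sum_(k in I) c k ^+ 2 * dot x (phi k) ^+ 2 = A * dot x x.
Proof.
have E x : \sum_(k in I) `|dot x (c k *: phi k)| ^+ 2 =
    \sum_(k in I) c k ^+ 2 * dot x (phi k) ^+ 2.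
  by apply: eq_bigr => k _; rewrite real_normK ?num_real // dotZr exprMn.
split=> fb x; last by rewrite E enorm_sqr fb.
by apply/eqP; rewrite eq_le; have := fb x; rewrite E enorm_sqr => -[-> ->].
Qed.

(** Scaling by [c k] weights the moments by [c k ^+ 2]. If all these weights were zero, the frame
    constant [A], itself a moment, would be zero. *)
Lemma tight_frame_lincomb (n : nat) (c : 'I_M -> R) (phi : 'I_M -> 'rV[R]_n.+1) :
  tight_frame I (fun k => c k *: phi k) ->
  \sum_(k in I) c k ^+ 2 *: F_map (phi k) = 0 /\ 0 < \sum_(k in I) c k ^+ 2.
Proof.
move=> [_ [A [A0 /frame_bounds_scaleP/sum_sqr_dotP mE]]]; split.
  by apply/lincomb_F_map_momentP => i j; rewrite !mE eqxx.
rewrite lt_def sumr_ge0 ?andbT => [|k _]; last exact: sqr_ge0.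
rewrite psumr_eq0 => [|k _]; last exact: sqr_ge0.
apply/allP => c0; have := mE 0 0; rewrite eqxx mulr1n /moment big1 => [A00|k kI].
  by rewrite A00 ltxx in A0.
by have /implyP/(_ kI)/eqP -> := c0 k (mem_index_enum k); rewrite mul0r.
Qed.

(** If the common diagonal moment were zero, each of its nonnegative terms would vanish, forcing a
    vector of positive weight to be zero. *)
Lemma lincomb_tight_frame (n : nat) (w : 'I_M -> R) (phi : 'I_M -> 'rV[R]_n.+1) :
  (n < #|I|)%N -> (forall k, phi k != 0) ->
  (forall k, k \in I -> 0 <= w k) -> 0 < \sum_(k in I) w k ->
  \sum_(k in I) w k *: F_map (phi k) = 0 ->
  exists2 A, 0 < A & forall x, \sum_(k in I) w k * dot x (phi k) ^+ 2 = A * dot x x.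
Proof.
move=> nI phi0 w0 ws /lincomb_F_map_momentP mE; exists (moment I w phi 0 0); last first.
  exact/sum_sqr_dotP.
have ge0 i k : k \in I -> 0 <= w k * (phi k 0 i * phi k 0 i).
  by move=> kI; rewrite mulr_ge0 ?w0 // -expr2 sqr_ge0.
rewrite lt_def sumr_ge0 ?andbT => [|k]; last exact: ge0.
apply: contraL ws => /eqP m0; rewrite -leNgt; apply: sumr_le0 => k kI.
rewrite leNgt; apply: contra (phi0 k) => wk; apply/eqP/rowP => i; rewrite mxE.
have /eqP := mE i i; rewrite m0 eqxx psumr_eq0 => [/allP/(_ k (mem_index_enum k))|j].
  by rewrite kI mulf_eq0 gt_eqF //= mulf_eq0 orbb => /eqP.
exact: ge0.
Qed.

(** Some weights may be zero, so the unscaled subfamily needs its own bounds: below, each weight is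
    at most the total; above, the bound of the full frame is inherited. *)
Lemma lincomb_frame (n : nat) (w : 'I_M -> R) (phi : 'I_M -> 'rV[R]_n.+1) :
  (n < #|I|)%N -> (forall k, phi k != 0) -> frame [set: 'I_M]%SET phi ->
  (forall k, k \in I -> 0 <= w k) -> 0 < \sum_(k in I) w k ->
  \sum_(k in I) w k *: F_map (phi k) = 0 ->
  frame I phi /\ tight_frame I (fun k => Num.sqrt (w k) *: phi k).
Proof.
move=> nI phi0 [_ [A0 [B [_ [B0 fb]]]]] w0 ws wF.
have [A A_gt0 wA] := lincomb_tight_frame nI phi0 w0 ws wF.
split; last first.
  split=> //; exists A; split=> //; apply/frame_bounds_scaleP => x; rewrite -wA.
  by apply: eq_bigr => k kI; rewrite sqr_sqrtr // w0.
split=> //; exists (A / \sum_(k in I) w k), B; split; first exact: divr_gt0.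
split=> // x; split.
  rewrite enorm_sqr mulrAC ler_pdivrMr // -wA mulr_suml; apply: ler_sum => k kI.
  rewrite real_normK ?num_real // mulrC ler_wpM2l ?sqr_ge0 //.
  by rewrite (bigD1 k) //= lerDl sumr_ge0 // => j /andP[/w0].
apply: (le_trans _ (fb x).2); rewrite big_mkcond /= [leRHS]big_mkcond /=.
by apply: ler_sum => k _; rewrite inE; case: ifP.
Qed.

End Frames.

(** * The equivalences for a fixed index set *)

Section Equivalences.
Variables (R : realType) (n M : nat) (phi : 'I_M -> 'rV[R]_n.+1).
Variable (I : {set 'I_M}).
Hypotheses (nI : (n < #|I|)%N) (phi0 : forall k, phi k != 0).
Hypothesis (phi_frame : frame [set: 'I_M]%SET phi).

Let F k := F_map (phi k).

Lemma scalable_convex_combP :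
  frame I phi /\ Defs.scalable I phi <->
  exists c : 'I_M -> R, [/\ forall k, k \in I -> 0 <= c k, \sum_(k in I) c k = 1 &
    \sum_(k in I) c k *: F k = 0].
Proof.
split=> [[_ [c [c0 /tight_frame_lincomb[cF cs]]]]|[c [c0 c1 cF]]].
  exists (fun k => (\sum_(k in I) c k ^+ 2)^-1 * c k ^+ 2); split.
  - by move=> k _; rewrite mulr_ge0 ?sqr_ge0 // invr_ge0 ltW.
  - by rewrite -mulr_sumr mulVf // gt_eqF.
  - by under eq_bigr do rewrite -scalerA; rewrite -scaler_sumr cF scaler0.
have [|fI tI] := lincomb_frame nI phi0 phi_frame c0 _ cF; first by rewrite c1.
by split=> //; exists (fun k => Num.sqrt (c k)); split=> // k _; exact: sqrtr_ge0.
Qed.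

Lemma convex_hull_F_image_sep :
  convex_hull (F_image phi I) 0 ->
  ~ exists h, forall k, k \in I -> 0 < dot (F k) h.
Proof.
move=> h0 [h hI]; suff: 0 < dot 0 h by rewrite dot0l ltxx.
by apply: convex_hull_gt0 h0 => _ [k /= kI <-]; exact: hI.
Qed.

(** A hull point is not expanded into a combination directly: 0 in the hull excludes a separator,
    and Gordan then supplies the coefficients. *)
Lemma convex_hull_F_imageP :
  convex_hull (F_image phi I) 0 <->
  exists c : 'I_M -> R, [/\ forall k, k \in I -> 0 <= c k, \sum_(k in I) c k = 1 &
    \sum_(k in I) c k *: F k = 0].
Proof.
split=> [/convex_hull_F_image_sep/gordan[c [c0 c1 cF]]|[c [c0 c1 <-]]].
  by exists c.
apply: convex_sum => //; first exact: smallest_convex.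
by move=> k kI; apply: sub_convex_hull; exists k.
Qed.

Lemma convex_hull_F_image_sepP :
  convex_hull (F_image phi I) 0 <->
  ~ exists h, forall k, k \in I -> 0 < dot (F k) h.
Proof.
split; first exact: convex_hull_F_image_sep.
by move=> /gordan[c [c0 c1 cF]]; apply/convex_hull_F_imageP; exists c.
Qed.

Lemma ri_convex_hull_F_image_sep :
  ri_convex_hull (F_image phi I) 0 ->
  ~ exists h, (forall k, k \in I -> 0 <= dot (F k) h) /\
      exists k, k \in I /\ 0 < dot (F k) h.
Proof.
move=> ri0 [h [hI [k [kI hk]]]].
have [|e e0 he] := ri_convex_hull_opp ri0 (v := F k); first by exists k.
suff: 0 <= dot (- e *: F k) h.
  by rewrite dotZl mulNr oppr_ge0 leNgt mulr_gt0.
by apply: convex_hull_ge0 he => _ [i /= iI <-]; exact: hI.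
Qed.

Lemma strictly_scalable_combP :
  frame I phi /\ strictly_scalable I phi <->
  exists c : 'I_M -> R, (forall k, k \in I -> 0 < c k) /\
    \sum_(k in I) c k *: F k = 0.
Proof.
split=> [[_ [c [c0 /tight_frame_lincomb[cF cs]]]]|[c [c0 cF]]].
  by exists (fun k => c k ^+ 2); split=> // k kI; rewrite exprn_gt0 ?c0.
have c0' k : k \in I -> 0 <= c k by move/c0/ltW.
have [|fI tI] := lincomb_frame nI phi0 phi_frame c0' _ cF.
  have /card_gt0P[i iI] := leq_ltn_trans (leq0n n) nI.
  rewrite (bigD1 i) //= ltr_pwDl ?c0 // sumr_ge0 // => k /andP[/c0' //].
split=> //; exists (fun k => Num.sqrt (c k)); split=> // k kI.
by rewrite sqrtr_gt0 c0.
Qed.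

(** The same cycle, with Stiemke in place of Gordan; the way back perturbs the positive
    coefficients. *)
Lemma ri_convex_hull_F_imageP :
  ri_convex_hull (F_image phi I) 0 <->
  exists c : 'I_M -> R, (forall k, k \in I -> 0 < c k) /\
    \sum_(k in I) c k *: F k = 0.
Proof.
split=> [/ri_convex_hull_F_image_sep/stiemke[c [c0 cF]]|[c [c0 cF]]].
  by exists c.
by apply: positive_comb_ri_convex_hull c0 cF; apply: leq_ltn_trans nI.
Qed.

Lemma ri_convex_hull_F_image_sepP :
  ri_convex_hull (F_image phi I) 0 <->
  ~ exists h, (forall k, k \in I -> 0 <= dot (F k) h) /\
      exists k, k \in I /\ 0 < dot (F k) h.
Proof.
split; first exact: ri_convex_hull_F_image_sep.
by move=> /stiemke[c [c0 cF]]; apply/ri_convex_hull_F_imageP; exists c.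
Qed.

End Equivalences.

Theorem theorem3p9 (R : realType) (N m M : nat)
    (hN : (2 <= N)%N) (hNm : (N <= m)%N) (hmM : (m <= M)%N)
    (phi : 'I_M -> 'rV[R]_N)
    (hphi : frame [set: 'I_M]%SET phi)
    (hphi0 : forall k, phi k != 0) :
  ((m_scalable m phi <->
    exists I : {set 'I_M}, #|I| = m /\ convex_hull (F_image phi I) 0)
   /\
   ((exists I : {set 'I_M}, #|I| = m /\ convex_hull (F_image phi I) 0) <->
    exists I : {set 'I_M}, #|I| = m /\
      ~ exists h : 'rV[R]_(quad_dim N),
          forall k, k \in I -> 0 < dot (F_map (phi k)) h))
  /\
  ((strictly_m_scalable m phi <->
    exists I : {set 'I_M}, #|I| = m /\ ri_convex_hull (F_image phi I) 0)
   /\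
   ((exists I : {set 'I_M}, #|I| = m /\ ri_convex_hull (F_image phi I) 0) <->
    exists I : {set 'I_M}, #|I| = m /\
      ~ exists h : 'rV[R]_(quad_dim N),
          (forall k, k \in I -> 0 <= dot (F_map (phi k)) h) /\
          (exists k, k \in I /\ 0 < dot (F_map (phi k)) h))).
Proof.
case: N hN hNm phi hphi hphi0 => // n _ nm phi hphi hphi0.
(* The same [I] serves on both sides, so the equivalences are proved set by set; [#|I| = m] gives
   the size bound. *)
have exI (P Q : {set 'I_M} -> Prop) :
    (forall I : {set 'I_M}, (n < #|I|)%N -> P I <-> Q I) ->
    (exists I : {set 'I_M}, #|I| = m /\ P I) <-> exists I : {set 'I_M}, #|I| = m /\ Q I.
  by move=> PQ; split=> -[I [Im PI]]; exists I; split=> //;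
    apply/PQ => //; rewrite Im.
split; split; apply: exI => I nI.
- rewrite (scalable_convex_combP nI hphi0 hphi).
  by apply: iff_sym; exact: convex_hull_F_imageP.
- exact: convex_hull_F_image_sepP.
- rewrite (strictly_scalable_combP nI hphi0 hphi).
  by apply: iff_sym; exact: ri_convex_hull_F_imageP.
- exact: ri_convex_hull_F_image_sepP.
Qed.
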